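(* For any integers $k\geq 2$ and $n\geq 1$, \[\Delta^k\big((f_k(1,n+k),f_k(2,n+k),\ldots,f_k(n+k,n+k))\big)=(f_k(1,n),f_k(2,n),\ldots,f_k(n,n)).\]
   Context: For $w\in S_n$ (the permutations of $[n]=\{1,\dots,n\}$) and $k\ge 2$, a $k$-descent of $w$ starts at index $i$ (with $1\le i\le n-k+1$) if $w(i)>w(i+1)>\cdots>w(i+k-1)$. Let $D_k(w)$ be the set of starting indices of $k$-descents in $w$. For $1\le m\le n$, $f_k(m,n)$ is the number of $w\in S_n$ with $D_k(w)=\emptyset$ and $w(1)=m$. The difference operator $\Delta$ on finite sequences of reals is $\Delta((a_1,\ldots,a_N))=(a_2-a_1,a_3-a_2,\ldots,a_N-a_{N-1})$ for $N\ge 2$, and $\Delta$ of a sequence of length $0$ or $1$ is the empty sequence. $\Delta^k$ is the $k$-th iterate of $\Delta$. *)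

(* Defs.v *)
From mathcomp Require Import all_boot all_order all_fingroup all_algebra.
From mathcomp Require Import reals.

Set Implicit Arguments.
Unset Strict Implicit.
Unset Printing Implicit Defensive.

Import GRing.Theory.

(* Permutations of {1, ..., n} are elements of 'S_n, which act on
   'I_n = {0, ..., n-1}: positions and values are both shifted down by 1. *)

Definition kdescent_at (k n : nat) (w : 'S_n) (i : 'I_n) : bool :=
  (i + k <= n) &&
  [forall j : 'I_n, forall j' : 'I_n,
     [&& i <= j, j' == j.+1 :> nat & j' < i + k] ==> (w j' < w j)].

Definition kdescents (k n : nat) (w : 'S_n) : {set 'I_n} :=
  [set i | kdescent_at k w i].

(* Here m is the 1-based first value, as in w(1) = m with 1 <= m <= n. *)
Definition fk (k m n : nat) : nat :=
  #|[set w : 'S_n | (kdescents k w == set0)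
       && [exists i : 'I_n, (i == 0 :> nat) && ((w i).+1 == m)]]|.

Definition Delta (V : zmodType) (s : seq V) : seq V :=
  mkseq (fun i => (s`_i.+1 - s`_i)%R) (size s).-1.

(* Main.v *)
Require Import Defs.
From mathcomp Require Import all_boot all_order all_fingroup all_algebra.
From mathcomp Require Import reals.
From mathcomp Require Import zify.

Set Implicit Arguments.
Unset Strict Implicit.
Unset Printing Implicit Defensive.

Import GRing.Theory.

(** Write f_n(m) for the number of permutations of n letters that avoid
    k-descents and start with m, and h_(p,n)(m) for the number of those whose
    first p entries, in addition, do not form a descent; thus h_(k,n) = f_n,
    and h_(1,n) = 0 because a single entry is always a descent of length 1.

    Deleting the first entry m of a permutation and flattening the remaining
    values sends a permutation starting with m to an arbitrary shorter one,
    starting say with m'.  The deleted entry extends the initial descent exactly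
    when m' < m (0-based values).  For 1 <= p < k this gives
      h_(p+1,n+1)(m) = sum of h_(p,n)(m') over m' < m
                       + sum of f_n(m') over m' >= m                   [start_count_rec].
    When m increases by one, only the index m' = m moves from the second sum
    to the first, so
      Delta h_(p+1,n+1) = h_(p,n) - f_n.
    Hence Delta f_(n+1) = h_(k-1,n) - h_(k,n), and in every further difference
    the two terms f_n cancel, so that each difference lowers both first indices
    by one:
      Delta^i f_(n+i) = h_(k-i,n) - h_(k-i+1,n)   for 1 <= i < k
                                                          [iter_Delta_start_count].
    At i = k - 1 this is - h_(2,n+1), on sequences of length n+1, and one last
    difference gives - (h_(1,n) - f_n) = f_n. *)

(** * Descents and deletion of the first entry *)

Lemma kdescent_atP (k n : nat) (w : 'S_n) (i : 'I_n) :
  reflect (i + k <= n /\ forall j j' : 'I_n,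
             i <= j -> j' = j.+1 :> nat -> j' < i + k -> w j' < w j)
          (kdescent_at k w i).
Proof.
apply: (iffP andP) => -[le_n desc]; split=> //.
  move=> j j' le_ij def_j' lt_j'; move/forallP/(_ j)/forallP/(_ j'): desc.
  by rewrite le_ij def_j' eqxx -def_j' lt_j'.
apply/forallP=> j; apply/forallP=> j'; apply/implyP=> /and3P[le_ij /eqP def_j'].
exact: desc.
Qed.

Lemma kdescent_at_leq (p q n : nat) (w : 'S_n) (i : 'I_n) :
  p <= q -> kdescent_at q w i -> kdescent_at p w i.
Proof.
move=> le_pq /kdescent_atP[le_n desc]; apply/kdescent_atP; split; first by lia.
by move=> j j' le_ij def_j' lt_j'; apply: desc => //; lia.
Qed.

Lemma kdescent_at1 (n : nat) (w : 'S_n) (i : 'I_n) : kdescent_at 1 w i.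
Proof.
apply/kdescent_atP; split=> [|j j' le_ij def_j' lt_j']; last by lia.
by have := ltn_ord i; lia.
Qed.

(** [lift_perm ord0 m s] is the permutation that starts with [m] and flattens
    to [s] once its first entry is deleted; flattening preserves the order. *)
Lemma lift_perm_ltn (n : nat) (m : 'I_n.+1) (s : 'S_n) (i j : 'I_n) :
  (lift_perm ord0 m s (lift ord0 i) < lift_perm ord0 m s (lift ord0 j))
  = (s i < s j).
Proof. by rewrite !lift_perm_lift /= /bump; case: leqP; case: leqP; lia. Qed.

Lemma lift_perm_ltn0 (n : nat) (m : 'I_n.+1) (s : 'S_n) (i : 'I_n) :
  (lift_perm ord0 m s (lift ord0 i) < lift_perm ord0 m s ord0) = (s i < m).
Proof.
by rewrite lift_perm_lift lift_perm_id /= /bump; case: leqP; lia.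
Qed.

Lemma kdescent_at_lift (p n : nat) (m : 'I_n.+1) (s : 'S_n) (i : 'I_n) :
  kdescent_at p (lift_perm ord0 m s) (lift ord0 i) = kdescent_at p s i.
Proof.
apply/kdescent_atP/kdescent_atP; rewrite lift0 => -[le_n desc]; split; try lia.
  move=> j j' le_ij def_j' lt_j'; rewrite -(lift_perm_ltn m).
  by apply: desc; rewrite !lift0; lia.
move=> j j'.
case: (unliftP ord0 j) => [j1|] ->; last by [].
case: (unliftP ord0 j') => [j1'|] ->; last by [].
rewrite !lift0 lift_perm_ltn => le_ij def_j' lt_j'.
by apply: desc; lia.
Qed.

Lemma kdescent_at_lift0 (p n : nat) (m : 'I_n.+2) (s : 'S_n.+1) :
  kdescent_at p.+2 (lift_perm ord0 m s) ord0
  = (s ord0 < m) && kdescent_at p.+1 s ord0.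
Proof.
apply/kdescent_atP/andP => [[le_n desc]|[lt_m /kdescent_atP[le_n desc]]].
  split; first by rewrite -lift_perm_ltn0; apply: desc; rewrite ?lift0.
  apply/kdescent_atP; split=> [|j j' _ def_j' lt_j']; first by move: le_n => /=; lia.
  by rewrite -(lift_perm_ltn m); apply: desc; rewrite ?lift0 //; lia.
split=> [|j j']; first by move: le_n => /=; lia.
case: (unliftP ord0 j') => [j1'|] ->; last by [].
case: (unliftP ord0 j) => [j1|] -> _.
  rewrite !lift0 lift_perm_ltn => def_j' lt_j'.
  by apply: desc => //; move: lt_j' => /=; lia.
rewrite lift0 lift_perm_ltn0 => -[def_j1'] _.
by rewrite (_ : j1' = ord0) //; apply: val_inj.
Qed.

(** Positions after the first carry the descents of [s], so only a descent at
    the first position can be new. *)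
Lemma kdescents_lift (k n : nat) (m : 'I_n.+2) (s : 'S_n.+1) :
  (kdescents k (lift_perm ord0 m s) == set0)
  = (kdescents k s == set0) && ~~ kdescent_at k (lift_perm ord0 m s) ord0.
Proof.
apply/eqP/andP => [/setP no_desc|[/eqP/setP no_desc nd0]].
  split; last by have:= no_desc ord0; rewrite !inE => ->.
  apply/eqP/setP => i; have:= no_desc (lift ord0 i).
  by rewrite !inE kdescent_at_lift.
apply/setP=> i; rewrite !inE; case: (unliftP ord0 i) => [i1|] ->; last exact: negbTE.
by rewrite kdescent_at_lift; have:= no_desc i1; rewrite !inE.
Qed.

(** Deletion of the first entry is a bijection from the permutations with a
    prescribed first value onto the permutations of one letter less. *)
Lemma sum_perm_lift (n : nat) (m : 'I_n.+1) (F : 'S_n.+1 -> nat) :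
  \sum_(w : 'S_n.+1 | w ord0 == m) F w = \sum_(s : 'S_n) F (lift_perm ord0 m s).
Proof.
rewrite (reindex (lift_perm ord0 m)) /=.
  by apply: eq_bigl => s; rewrite lift_perm_id eqxx.
(* [g w] is [w] with its first entry deleted; the default value [i] never
   occurs, as the values of [w] after position 0 differ from [w ord0]. *)
pose g (w : 'S_n.+1) (i : 'I_n) := odflt i (unlift (w ord0) (w (lift ord0 i))).
have gE (w : 'S_n.+1) i : lift (w ord0) (g w i) = w (lift ord0 i).
  rewrite /g; case: unliftP => [j -> //|/perm_inj e].
  by have := neq_lift ord0 i; rewrite e eqxx.
have g_inj w : injective (g w).
  move=> i j eq_g; apply: (@lift_inj _ ord0); apply: (@perm_inj _ w).
  by rewrite -!gE eq_g.
exists (fun w => perm (g_inj w)) => [s _|w /eqP <-].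
  apply/permP=> i; rewrite permE; apply: (@lift_inj _ m).
  by rewrite -{1}(lift_perm_id ord0 m s) gE lift_perm_lift.
apply/permP=> i.
case: (unliftP ord0 i) => [j|] ->; last by rewrite lift_perm_id.
by rewrite lift_perm_lift permE gE.
Qed.

(** * Counting by first value and initial descent *)

(** Both the first value [m] and the size are shifted: the count runs over
    permutations of [n.+1] letters with 0-based first value [m], so that a first
    entry always exists. *)
Definition start_count (k p m n : nat) : nat :=
  \sum_(w : 'S_n.+1 | w ord0 == m :> nat)
     ((kdescents k w == set0) && ~~ kdescent_at p w ord0).

(** Avoiding k-descents already excludes one at the first position. *)
Lemma fk_start_count (k m n : nat) : fk k m.+1 n.+1 = start_count k k m n.
Proof.
rewrite /fk /start_count -sum1_card [RHS]big_mkcond [LHS]big_mkcond /=.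
apply: eq_bigr => w _; rewrite inE.
have -> : [exists i : 'I_n.+1, (i == 0 :> nat) && ((w i).+1 == m.+1)]
          = (w ord0 == m :> nat).
  apply/existsP/idP => [[i /andP[/eqP i0]]|w0]; last by exists ord0; rewrite eqSS.
  by rewrite eqSS (_ : i = ord0) //; apply: val_inj.
case: (w ord0 == m :> nat); rewrite ?andbF ?andbT //.
case: eqP => //= /setP/(_ ord0); rewrite !inE => ->; by [].
Qed.

Lemma start_count1 (k m n : nat) : start_count k 1 m n = 0.
Proof. by rewrite /start_count big1 // => w _; rewrite kdescent_at1 andbF. Qed.

(** Delete the first entry [m].  If the next value [m'] is at least [m], the
    deleted entry starts no descent, and the rest need only avoid k-descents.
    If [m' < m], it prolongs the initial descent of the rest by one entry, so the
    rest must not start with a p-descent; as [p < k], this also keeps the whole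
    permutation free of a k-descent at its first position. *)
Lemma start_count_rec (k p m n : nat) : 0 < p < k -> m <= n.+1 ->
  start_count k p.+1 m n.+1
  = \sum_(m' < n.+1) (if m' < m then start_count k p m' n else start_count k k m' n).
Proof.
case: p => // p /andP[_ lt_pk] le_m.
have ltm : m < n.+2 by [].
transitivity (\sum_(s : 'S_n.+1) ((kdescents k s == set0) &&
    ~~ kdescent_at (if s ord0 < m then p.+1 else k) s ord0)).
  rewrite /start_count (sum_perm_lift (Ordinal ltm)
    (fun w => ((kdescents k w == set0) && ~~ kdescent_at p.+2 w ord0) : nat)).
  apply: eq_bigr => s _; rewrite kdescents_lift -andbA -negb_or.
  (* Since [p.+2 <= k], an initial k-descent is in particular an initial
     descent of length [p.+2]. *)
  rewrite (_ : _ || _ = kdescent_at p.+2 (lift_perm ord0 (Ordinal ltm) s) ord0).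
    rewrite kdescent_at_lift0 /=; case: ifP => //= _.
    by case: eqP => //= /setP/(_ ord0); rewrite !inE => ->.
  by apply/idP/idP => [/orP[/kdescent_at_leq->|]|->] //; rewrite orbT.
rewrite (partition_big (fun s : 'S_n.+1 => s ord0) xpredT) //=.
apply: eq_bigr => i _; rewrite -(fun_if (fun q => start_count k q i n)).
by apply: eq_bigr => s /eqP ->.
Qed.

(** The recursions for [m] and [m.+1] differ only in the term of index [m]. *)
Lemma start_count_diff (k p m n : nat) : 0 < p < k -> m <= n ->
  start_count k p.+1 m.+1 n.+1 + start_count k k m n
  = start_count k p.+1 m n.+1 + start_count k p m n.
Proof.
move=> hp le_m; rewrite !start_count_rec ?(leq_trans le_m) //.
have ltm : m < n.+1 by [].
rewrite (bigD1 (Ordinal ltm)) // [in RHS](bigD1 (Ordinal ltm)) //= ltnSn ltnn.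
rewrite addnAC [RHS]addnAC [in RHS](addnC (start_count k k m n)); congr (_ + _).
apply: eq_bigr => i; rewrite -val_eqE /= => ne_im.
by rewrite ltnS leq_eqVlt (negbTE ne_im).
Qed.

(** * Iterated differences *)

Section Differences.

Local Open Scope ring_scope.

Lemma Delta_mkseq (V : zmodType) (g h : nat -> V) (n : nat) :
  (forall m, (m <= n)%N -> g m.+1 - g m = h m) ->
  Delta (mkseq g n.+2) = mkseq h n.+1.
Proof.
move=> gh; rewrite /Delta size_mkseq.
apply/eq_in_map => m; rewrite mem_iota => lt_m.
by rewrite !nth_mkseq ?gh //; lia.
Qed.

Lemma start_count_diffR (R : pzRingType) (k p m n : nat) : (0 < p < k)%N -> (m <= n)%N ->
  (start_count k p.+1 m.+1 n.+1)%:R - (start_count k p.+1 m n.+1)%:R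
  = (start_count k p m n)%:R - (start_count k k m n)%:R :> R.
Proof.
move=> hp le_m; apply/eqP; rewrite subr_eq addrAC eq_sym subr_eq -!natrD addnC.
by rewrite start_count_diff.
Qed.

(** By [start_count_diff], differencing [start_count k p.+1] on longer
    permutations yields [start_count k p - start_count k k]; the subtracted term
    does not depend on [p], so it cancels in a difference of two such counts. *)
Lemma iter_Delta_start_count (R : pzRingType) (k i n : nat) : (i.+1 < k)%N ->
  iter i.+1 (@Delta R)
    (mkseq (fun m => (start_count k k m (n + i.+1))%:R) (n + i.+1).+1)
  = mkseq (fun m => (start_count k (k - i.+1) m n)%:R
                   - (start_count k (k - i) m n)%:R) n.+1.
Proof.
elim: i n => [|i IHi] n lt_ik.
  rewrite addn1; apply: Delta_mkseq => m le_m.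
  by rewrite subn0 -start_count_diffR ?subn1 ?prednK //; lia.
rewrite addnS -addSn iterS IHi 1?ltnW //; apply: Delta_mkseq => m le_m.
have -> : (k - i = (k - i.+1).+1)%N by lia.
have -> : (k - i.+1 = (k - i.+2).+1)%N by lia.
rewrite opprD addrACA -opprD !start_count_diffR; [|lia..].
by rewrite opprD addrACA subrr addr0.
Qed.

End Differences.

Theorem theorem2p2 (R : realType) (k n : nat) (hk : 2 <= k) (hn : 1 <= n) :
  iter k (@Delta R) [seq ((fk k m (n + k))%:R)%R | m <- iota 1 (n + k)]
  = [seq ((fk k m n)%:R)%R | m <- iota 1 n].
Proof.
(* [k] becomes [k.+2], so that the first [k.+1] differences come from
   [iter_Delta_start_count]; the last one is taken by hand, the other count
   [start_count k.+2 1] being zero. *)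
case: n hn => // n _; case: k hk => [|[|k]] // _.
have fk_mkseq N : [seq ((fk k.+2 m N.+1)%:R)%R | m <- iota 1 N.+1]
    = mkseq (fun m => (start_count k.+2 k.+2 m N)%:R)%R N.+1 :> seq R.
  rewrite -[X in iota X]addn0 iotaDl -map_comp.
  by apply: eq_map => m /=; rewrite add1n fk_start_count.
rewrite addSn !fk_mkseq iterS addnS -addSn iter_Delta_start_count //.
apply: Delta_mkseq => m le_m.
rewrite subSnn subSn // subSnn !start_count1 !add0r -opprD.
by rewrite start_count_diffR // start_count1 sub0r opprK.
Qed.
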